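(* Let $\lambda$ be a limit stage of a countable-support symmetric iteration as described in the context, with symmetric system $\langle\mathbb P_\lambda,\mathcal G_\lambda,\tilde{\mathcal F}_\lambda\rangle$ at stage $\lambda$, where $\tilde{\mathcal F}_\lambda$ is the limit filter, and call a $\mathbb P_\lambda$-name HS if it is hereditarily $\tilde{\mathcal F}_\lambda$-symmetric. Let $\langle\dot x_n:n<\omega\rangle$ be a sequence that belongs to the ground model $V$, and suppose every $\dot x_n$ is an HS name. Then the canonical name $\langle\dot x_n:n<\omega\rangle$ for the ordered tuple is HS. In particular, HS names are closed under ground-coded finite tuples (i.e. the canonical name of a finite tuple of HS names, the tuple belonging to $V$, is HS).
   Context: Everything takes place in a fixed background (ground) universe $V\models\mathsf{ZF}$; ''countable'' means countable in $V$. Filters of subgroups. For a group $\mathcal G$, a filter of subgroups $\mathcal F$ on $\mathcal G$ is a nonempty collection of subgroups of $\mathcal G$ with: $\mathcal G\in\mathcal F$; if $H\in\mathcal F$ and $H\le K\le\mathcal G$ then $K\in\mathcal F$; if $H,K\in\mathcal F$ then $H\cap K\in\mathcal F$. It is normal if $\pi H\pi^{-1}\in\mathcal F$ for all $H\in\mathcal F$, $\pi\in\mathcal G$. It is $\omega_1$-complete if $\bigcap_{n<\omega}H_n\in\mathcal F$ whenever $H_n\in\mathcal F$ for all $n<\omega$. The $\omega_1$-completion $\mathcal F^{\omega_1}$ of a normal filter $\mathcal F$ is the set of subgroups $K\le\mathcal G$ for which there is a sequence $\langle H_n:n<\omega\rangle$ of members of $\mathcal F$ with $\bigcap_{n<\omega}H_n\le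 K$. Symmetric systems and names. A symmetric system is a triple $\langle\mathbb P,\mathcal G,\mathcal F\rangle$ with $\mathbb P$ a forcing notion (poset with top $1_{\mathbb P}$), $\mathcal G\le\mathrm{Aut}(\mathbb P)$ a group of order automorphisms fixing $1_{\mathbb P}$, and $\mathcal F$ a normal filter of subgroups of $\mathcal G$. A $\mathbb P$-name is (recursively) a set of pairs $\langle\dot y,p\rangle$ with $\dot y$ a $\mathbb P$-name and $p\in\mathbb P$. The action of $\pi\in\mathcal G$ on names is $\pi\dot x=\{\langle\pi\dot y,\pi p\rangle:\langle\dot y,p\rangle\in\dot x\}$, and $\mathrm{sym}(\dot x)=\{\pi\in\mathcal G:\pi\dot x=\dot x\}$. A name $\dot x$ is $\mathcal F$-symmetric if $\mathrm{sym}(\dot x)\in\mathcal F$; it is hereditarily $\mathcal F$-symmetric if it is $\mathcal F$-symmetric and every $\dot y\in\mathrm{dom}(\dot x)$ is (recursively) hereditarily $\mathcal F$-symmetric. Canonical tuple name. As usual, $\check x=\{\langle\check y,1_{\mathbb P}\rangle:y\in x\}$; the canonical name for the ordered pair of $\dot a,\dot b$ is $\mathrm{op}(\dot a,\dot b)=\{\langle\{\langle\dot a,1_{\mathbb P}\rangle\},1_{\mathbb P}\rangle,\langle\{\langle\dot a,1_{\mathbb P}\rangle,\langle\dot b,1_{\mathbb P}\rangle\},1_{\mathbb P}\rangle\}$; and the canonical name for the tuple indexed by $J$ (with $J=\omega$ or $J$ finite, $J\in\omega$) is $\{\langle\mathrm{op}(\check j,\dot x_j),1_{\mathbb P}\rangle:j\in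 J\}$. Countable-support symmetric iteration of length $\Theta$. This consists of $\langle(\mathbb P_\alpha,\mathcal G_\alpha,\mathcal F_\alpha):\alpha\le\Theta\rangle$ together with, for each $\alpha<\Theta$, a $\mathbb P_\alpha$-name $\langle\dot{\mathbb Q}_\alpha,\dot{\mathcal H}_\alpha,\dot{\mathcal K}_\alpha\rangle$ forced by $1_{\mathbb P_\alpha}$ to be a symmetric system, and restriction homomorphisms $\rho_{\gamma,\beta}:\mathcal G_\beta\to\mathcal G_\gamma$ for $\gamma\le\beta\le\Theta$ which are coherent: $\rho_{\gamma,\gamma}=\mathrm{id}$ and $\rho_{\gamma,\beta}=\rho_{\gamma,\delta}\circ\rho_{\delta,\beta}$ for $\gamma\le\delta\le\beta$. The recursion is: - Stage $0$: $\mathbb P_0=\{1\}$, $\mathcal G_0=\{\mathrm{id}\}$, $\mathcal F_0=\{\mathcal G_0\}$. - Stage $\alpha+1$: $\mathbb P_{\alpha+1}=\mathbb P_\alpha*\dot{\mathbb Q}_\alpha$; $\mathcal G_{\alpha+1}$ and a filter $\mathcal F^{\mathrm{Kar}}_{\alpha+1}$ come from the standard two-step symmetric-system construction: there is a head-restriction homomorphism $\rho_{\alpha,\alpha+1}:\mathcal G_{\alpha+1}\to\mathcal G_\alpha$, and $\mathcal F^{\mathrm{Kar}}_{\alpha+1}$ is a normal filter of subgroups of $\mathcal G_{\alpha+1}$ extending the pullbacks $\rho_{\alpha,\alpha+1}^{-1}(H)$ for $H\in\mathcal F_\alpha$ and the tail symmetries coming from $\dot{\mathcal K}_\alpha$.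 Then $\mathcal F_{\alpha+1}:=(\mathcal F^{\mathrm{Kar}}_{\alpha+1})^{\omega_1}$. - Limit stage $\lambda$ with $\mathrm{cf}(\lambda)=\omega$: $\mathbb P_\lambda$ is the usual countable-support limit (conditions are partial functions $p$ with countable domain $\mathrm{dom}(p)\subseteq\lambda$, with $p(\beta)$ a $\mathbb P_\beta$-name for a condition in $\dot{\mathbb Q}_\beta$; $q\le p$ iff $\mathrm{dom}(q)\supseteq\mathrm{dom}(p)$ and $q\upharpoonright\beta\Vdash_{\mathbb P_\beta}q(\beta)\le p(\beta)$ for all $\beta\in\mathrm{dom}(p)$). $\mathcal G_\lambda$ is the inverse limit of $\langle\mathcal G_\beta,\rho_{\gamma,\beta}:\gamma<\beta<\lambda\rangle$, with $\rho_{\beta,\lambda}$ the projections, acting on $\mathbb P_\lambda$ by automorphisms coordinatewise: for $g=\langle g_\beta:\beta<\lambda\rangle$, $(g\cdot p)(\beta)=g_\beta\cdot p(\beta)$ for $\beta\in\mathrm{dom}(p)$. - Limit stage $\lambda$ with $\mathrm{cf}(\lambda)\ge\omega_1$: the countable-support limit is identified with the direct limit, $\mathbb P_\lambda=\bigcup_{\beta<\lambda}\mathbb P_\beta$ and $\mathcal G_\lambda=\bigcup_{\beta<\lambda}\mathcal G_\beta$ (elements of $\mathcal G_\beta$ being identified with their canonical extensions), with the evident coherent restriction homomorphisms $\rho_{\beta,\lambda}:\mathcal G_\lambda\to\mathcal G_\beta$. - At every limit stage $\lambda$, $\mathcal F_\lambda:=\tilde{\mathcal F}_\lambda$, the limit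 filter defined next. Standing inductive assumption: each $\mathcal F_\beta$, $\beta<\lambda$, is a normal $\omega_1$-complete filter of subgroups on $\mathcal G_\beta$. Limit filter. Let $\mathcal B_\lambda=\{\rho_{\beta,\lambda}^{-1}(H):\beta<\lambda,\ H\in\mathcal F_\beta\}$. (i) If $\mathrm{cf}(\lambda)\ge\omega_1$, $\tilde{\mathcal F}_\lambda$ is the normal filter on $\mathcal G_\lambda$ generated by $\mathcal B_\lambda$; explicitly, a subgroup $K\le\mathcal G_\lambda$ is in $\tilde{\mathcal F}_\lambda$ iff there are $k<\omega$, $B_0,\dots,B_{k-1}\in\mathcal B_\lambda$ and $g_0,\dots,g_{k-1}\in\mathcal G_\lambda$ with $\bigcap_{i<k}g_iB_ig_i^{-1}\le K$. (ii) If $\mathrm{cf}(\lambda)=\omega$, $\tilde{\mathcal F}_\lambda$ is the normal $\omega_1$-complete filter on $\mathcal G_\lambda$ generated by $\mathcal B_\lambda$; explicitly, a subgroup $K\le\mathcal G_\lambda$ is in $\tilde{\mathcal F}_\lambda$ iff there are sequences $\langle B_n:n<\omega\rangle\in\mathcal B_\lambda^\omega$ and $\langle g_n:n<\omega\rangle\in\mathcal G_\lambda^\omega$ with $\bigcap_{n<\omega}g_nB_ng_n^{-1}\le K$. *)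

(* Defs.v *)
From Stdlib Require Import Relation_Operators Transitive_Closure.
From mathcomp Require Import all_boot.
From mathcomp Require Import boolp classical_sets.

Set Implicit Arguments.
Unset Strict Implicit.
Unset Printing Implicit Defensive.

Local Open Scope classical_set_scope.

(** * The ground universe *)

(* The background universe V of ZF.  Separation and Replacement range over all
   predicates and relations, since V is the universe in which the mathematics
   takes place, so that families indexed by a set of V are elements of V.
   The operations are the unique ones given by Extensionality; choice is not
   part of the structure. *)
Record zf_universe := ZFUniverse {
  zf_sort :> Type;
  zf_in : zf_sort -> zf_sort -> Prop;
  zf_upair : zf_sort -> zf_sort -> zf_sort;
  zf_union : zf_sort -> zf_sort;
  zf_power : zf_sort -> zf_sort;
  zf_sep : (zf_sort -> Prop) -> zf_sort -> zf_sort;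
  zf_repl : (zf_sort -> zf_sort -> Prop) -> zf_sort -> zf_sort;
  zf_inf : zf_sort;
  zf_ext : forall a b, (forall x, zf_in x a <-> zf_in x b) -> a = b;
  zf_foundation : well_founded zf_in;
  zf_upairP : forall a b x, zf_in x (zf_upair a b) <-> x = a \/ x = b;
  zf_unionP : forall a x,
    zf_in x (zf_union a) <-> exists2 y, zf_in y a & zf_in x y;
  zf_powerP : forall a x,
    zf_in x (zf_power a) <-> forall y, zf_in y x -> zf_in y a;
  zf_sepP : forall (A : zf_sort -> Prop) a x,
    zf_in x (zf_sep A a) <-> zf_in x a /\ A x;
  zf_replP : forall (R : zf_sort -> zf_sort -> Prop) a,
    (forall x y z, zf_in x a -> R x y -> R x z -> y = z) ->
    forall y, zf_in y (zf_repl R a) <-> exists2 x, zf_in x a & R x y;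
  zf_infP :
    (exists2 e, zf_in e zf_inf & forall x, ~ zf_in x e) /\
    (forall x, zf_in x zf_inf ->
       exists2 y, zf_in y zf_inf & forall z, zf_in z y <-> zf_in z x \/ z = x)
}.

Notation "x ∈ a" := (zf_in x a) (at level 70, no associativity).

Section SetTheory.
Context {V : zf_universe}.
Implicit Types a b f x y z : V.

Definition vsub a b := forall x, x ∈ a -> x ∈ b.
Definition vempty : V := zf_sep (fun=> False) (zf_inf V).
Definition vsingle x : V := zf_upair x x.
Definition vcup a b : V := zf_union (zf_upair a b).
Definition vsucc x : V := vcup x (vsingle x).

Definition inductive_set a :=
  vempty ∈ a /\ forall x, x ∈ a -> vsucc x ∈ a.
Definition omega : V :=
  zf_sep (fun n => forall a, inductive_set a -> n ∈ a) (zf_inf V).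

Definition opair x y : V := zf_upair (vsingle x) (zf_upair x y).

Lemma opair_inj x y x' y' : opair x y = opair x' y' -> x = x' /\ y = y'.
Proof.
have s1 u v : u ∈ vsingle v <-> u = v.
  by rewrite zf_upairP; split=> [[]|->]; [| |left].
have si u v : vsingle u = vsingle v -> u = v by move=> e; rewrite -s1 -e s1.
have sp u v w : vsingle u = zf_upair v w -> u = v /\ u = w.
  move=> e; split; apply/esym/s1; rewrite e; apply/zf_upairP; [by left|by right].
move=> e.
have inl u v : u ∈ zf_upair u v by apply/zf_upairP; left.
have inr u v : v ∈ zf_upair u v by apply/zf_upairP; right.
have xx' : x = x'.
  have : vsingle x ∈ opair x' y' by rewrite -e; exact: inl.
  by move=> /zf_upairP[/si//|E]; have [] := sp _ _ _ E.
split=> //; subst x'.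
have /zf_upairP H1 : zf_upair x y ∈ opair x y' by rewrite -e; exact: inr.
have /zf_upairP H2 : zf_upair x y' ∈ opair x y by rewrite e; exact: inr.
case: H1 => [/esym/sp[_ xy]|E].
  by subst y; case: H2 => E'; have [_] := sp _ _ _ (esym E').
have /zf_upairP[yx|//] : y ∈ zf_upair x y' by rewrite -E; exact: inr.
by rewrite yx in E *; have [_] := sp _ _ _ E.
Qed.

Definition is_pfun f :=
  (forall z, z ∈ f -> exists x y, z = opair x y) /\
  (forall x y y', opair x y ∈ f -> opair x y' ∈ f -> y = y').
Definition vdom f : V :=
  zf_sep (fun x => exists y, opair x y ∈ f) (zf_union (zf_union f)).
(* the value f(x): the union of {y | (x, y) in f} *)
Definition vapp f x : V :=
  zf_union (zf_sep (fun y => opair x y ∈ f) (zf_union (zf_union f))).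
Definition vrestr f a : V :=
  zf_sep (fun z => exists x y, x ∈ a /\ z = opair x y) f.
Definition fun_on f a := is_pfun f /\ vdom f = a.
Definition fun_to f a b := fun_on f a /\ forall x, x ∈ a -> vapp f x ∈ b.

Definition vcountable a := exists f, fun_to f a omega /\
  forall x y, x ∈ a -> y ∈ a -> vapp f x = vapp f y -> x = y.

Definition transitive_set a := forall x, x ∈ a -> vsub x a.
Definition is_ord a :=
  transitive_set a /\ forall x, x ∈ a -> transitive_set x.
Definition ord_le a b := a ∈ vsucc b.
Definition is_limit a :=
  [/\ is_ord a, a <> vempty & forall x, x ∈ a -> vsucc x ∈ a].

Definition cofinal_map f a b :=
  fun_to f a b /\ forall x, x ∈ b -> exists2 y, y ∈ a & ord_le x (vapp f y).
Definition is_cf a k :=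
  [/\ is_ord k, exists f, cofinal_map f k a &
      forall d, d ∈ k -> ~ exists f, cofinal_map f d a].
Definition cf_omega a := is_cf a omega.
(* cf(a) >= omega_1, as omega_1 is the least uncountable ordinal *)
Definition cf_ge_omega1 a := exists2 k, is_cf a k & ~ vcountable k.

End SetTheory.

Arguments vempty {V}.
Arguments omega {V}.

(** * Groups of permutations and filters of subgroups *)

Section Groups.
Variable T : Type.
Implicit Types (G H K : set (T -> T)) (F : set (set (T -> T))).

Definition is_group G :=
  [/\ G id, forall f g, G f -> G g -> G (f \o g) &
      forall f, G f -> exists g, [/\ G g, f \o g = id & g \o f = id]].
Definition is_subgroup H G := H `<=` G /\ is_group H.
(* g H g^-1, for a permutation g *)
Definition conjugate (g : T -> T) H : set (T -> T) :=
  [set k : T -> T | exists2 h : T -> T, H h & k \o g = g \o h].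

Definition subgroup_filter G F :=
  [/\ forall H, F H -> is_subgroup H G,
      F G,
      forall H K, F H -> H `<=` K -> is_subgroup K G -> F K &
      forall H K, F H -> F K -> F (H `&` K)].
Definition normal_filter G F :=
  subgroup_filter G F /\ forall H g, F H -> G g -> F (conjugate g H).
Definition omega1_complete F :=
  forall H : nat -> set (T -> T), (forall n, F (H n)) -> F (\bigcap_n H n).
Definition omega1_completion G F : set (set (T -> T)) :=
  [set K | is_subgroup K G /\
     exists2 H : nat -> set (T -> T),
       forall n, F (H n) & \bigcap_n H n `<=` K].

End Groups.

(** * Forcing notions *)

Record poset (V : zf_universe) := Poset {
  carrier : V;
  ple : V -> V -> Prop;
  pone : V
}.

Section Forcing.
Context {V : zf_universe}.
Variable P : poset V.
Implicit Types (p q r x y z w : V) (g : V -> V).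

Definition forcing_notion :=
  [/\ pone P ∈ carrier P,
      forall p, p ∈ carrier P -> ple P p p /\ ple P p (pone P) &
      forall p q r, p ∈ carrier P -> q ∈ carrier P -> r ∈ carrier P ->
        ple P p q -> ple P q r -> ple P p r].

(* An automorphism of P is represented by its extension to V that is the
   identity outside P, so that equal automorphisms are equal functions. *)
Definition is_aut g :=
  [/\ (forall p, p ∈ carrier P -> g p ∈ carrier P) /\
      (forall p, ~ p ∈ carrier P -> g p = p),
      forall q, q ∈ carrier P -> exists2 p, p ∈ carrier P & g p = q,
      forall p q, p ∈ carrier P -> q ∈ carrier P -> g p = g q -> p = q,
      forall p q, p ∈ carrier P -> q ∈ carrier P ->
        (ple P p q <-> ple P (g p) (g q)) &
      g (pone P) = pone P].
Definition aut_group (G : set (V -> V)) := is_group G /\ G `<=` is_aut.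

(** ** Names *)

Inductive is_name : V -> Prop :=
  IsName x : (forall z, z ∈ x ->
    exists y p, [/\ z = opair y p, is_name y & p ∈ carrier P]) -> is_name x.

Definition name_dom x : set V := [set y | exists p, opair y p ∈ x].

Lemma name_dom_wf : well_founded (fun y x => name_dom x y).
Proof.
move=> x; elim: (wf_clos_trans _ _ (@zf_foundation V) x) => {}x _ IH.
constructor => y [p yx]; apply: IH.
apply: t_trans (t_step _ _ _ _ yx); apply: (t_trans _ _ _ (vsingle y)).
  by apply: t_step; apply/zf_upairP; left.
by apply: t_step; apply/zf_upairP; left.
Qed.

(* g x = {(g y, g p) | (y, p) in x} *)
Definition name_act g : V -> V :=
  Fix name_dom_wf (fun=> V) (fun x rec =>
    zf_repl (fun z w => exists y p (yx : name_dom x y),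
      z = opair y p /\ w = opair (rec y yx) (g p)) x).

(* x-check = {(y-check, 1) | y in x} *)
Definition check : V -> V :=
  Fix (@zf_foundation V) (fun=> V) (fun x rec =>
    zf_repl (fun y w => exists yx : y ∈ x, w = opair (rec y yx) (pone P)) x).

Definition op_name x y : V :=
  zf_upair (opair (vsingle (opair x (pone P))) (pone P))
           (opair (zf_upair (opair x (pone P)) (opair y (pone P))) (pone P)).

(* the canonical name of the tuple x indexed by J *)
Definition tuple_name (J x : V) : V :=
  zf_repl (fun j w => w = opair (op_name (check j) (vapp x j)) (pone P)) J.

Lemma name_actE g x z : z ∈ name_act g x <->
  exists y p, opair y p ∈ x /\ z = opair (name_act g y) (g p).
Proof.
rewrite /name_act Fix_eq => [|{}x f h fh]; last first.
  by congr zf_repl; apply/funext => z'; apply/funext => w; apply/propext;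
    split=> -[y [p [yx [-> ->]]]]; exists y, p, yx; rewrite fh.
rewrite zf_replP => [|z' w w' _ [y [p [_ [-> ->]]]]]; last first.
  by move=> [y' [p' [_ [/opair_inj[-> ->] ->]]]].
split=> [[z' z'x [y [p [yx [z'E ->]]]]]|[y [p [ypx ->]]]].
  by exists y, p; rewrite -z'E.
by exists (opair y p) => //; exists y, p, (ex_intro _ p ypx).
Qed.

Lemma checkE x z :
  z ∈ check x <-> exists2 y, y ∈ x & z = opair (check y) (pone P).
Proof.
rewrite /check Fix_eq => [|{}x f h fh]; last first.
  by congr zf_repl; apply/funext => y; apply/funext => w; apply/propext;
    split=> -[yx ->]; exists yx; rewrite fh.
rewrite zf_replP => [|y w w' _ [_ ->] [_ ->] //].
split=> [[y yx [_ ->]]|[y yx ->]]; first by exists y.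
by exists y => //; exists yx.
Qed.

Section Symmetry.
Variables (G : set (V -> V)) (F : set (set (V -> V))).

Definition sym x : set (V -> V) := [set g | G g /\ name_act g x = x].

Inductive hereditarily_symmetric : V -> Prop :=
  HereditarilySymmetric x : F (sym x) ->
    (forall y, name_dom x y -> hereditarily_symmetric y) ->
    hereditarily_symmetric x.

Definition HS x := is_name x /\ hereditarily_symmetric x.

End Symmetry.

(** ** The forcing relation *)

(* p ||- x = y, by recursion on names: below p, every element of either name
   is densely forced to be an element of the other. *)
Inductive feq : V -> V -> V -> Prop :=
  FEq x y p :
    (forall w r q, opair w r ∈ x -> q ∈ carrier P -> ple P q p -> ple P q r ->
       exists q' w' r', [/\ q' ∈ carrier P, ple P q' q, opair w' r' ∈ y,
                            ple P q' r' & feq w w' q']) ->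
    (forall w' r' q, opair w' r' ∈ y -> q ∈ carrier P -> ple P q p ->
       ple P q r' ->
       exists q' w r, [/\ q' ∈ carrier P, ple P q' q, opair w r ∈ x,
                          ple P q' r & feq w w' q']) ->
    feq x y p.

(* A sentence of the forcing language is the set of conditions forcing it. *)
Definition sentence := V -> Prop.

Definition fmem x y : sentence := fun p =>
  forall q, q ∈ carrier P -> ple P q p ->
  exists q' w r, [/\ q' ∈ carrier P, ple P q' q, opair w r ∈ y,
                     ple P q' r & feq x w q'].
Definition fand (A B : sentence) : sentence := fun p => A p /\ B p.
Definition fimp (A B : sentence) : sentence := fun p =>
  forall q, q ∈ carrier P -> ple P q p -> A q -> B q.
Definition fiff A B := fand (fimp A B) (fimp B A).
Definition fall (A : V -> sentence) : sentence := fun p =>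
  forall x, is_name x -> A x p.
Definition fex (A : V -> sentence) : sentence := fun p =>
  forall q, q ∈ carrier P -> ple P q p ->
  exists q' x, [/\ q' ∈ carrier P, ple P q' q, is_name x & A x q'].
Definition fallin y (A : V -> sentence) := fall (fun x => fimp (fmem x y) (A x)).
Definition fexin y (A : V -> sentence) := fex (fun x => fand (fmem x y) (A x)).

Definition forced (A : sentence) := A (pone P).

(** ** The sentence "(Q, H, K) is a symmetric system" *)

Local Infix "&&&" := fand (at level 40, left associativity).

(* In this section Q, leQ, oneQ, H, K and the bound variables are P-names. *)
Section ForcedSymmetricSystem.
Variables (Q leQ oneQ H K : V).

Definition frel f x y : sentence := fmem (op_name x y) f.

Definition f_forcing_notion : sentence :=
  fmem oneQ Q &&&
  fallin Q (fun x => frel leQ x x &&& frel leQ x oneQ) &&&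
  fallin Q (fun x => fallin Q (fun y => fallin Q (fun z =>
    fimp (frel leQ x y) (fimp (frel leQ y z) (frel leQ x z))))).

Definition f_aut f : sentence :=
  fallin f (fun u => fexin Q (fun x => fexin Q (fun y => feq u (op_name x y))))
  &&& fallin Q (fun x => fexin Q (fun y => frel f x y))
  &&& fallin Q (fun y => fexin Q (fun x => frel f x y))
  &&& fallin Q (fun x => fallin Q (fun x' =>
        fallin Q (fun y => fallin Q (fun y' =>
          fimp (frel f x y) (fimp (frel f x' y')
            (fiff (feq x x') (feq y y') &&&
             fiff (frel leQ x x') (frel leQ y y')))))))
  &&& frel f oneQ oneQ.

(* h = f o g, for functions f, g, h on Q *)
Definition f_comp (f g h : V) : sentence :=
  fallin Q (fun x => fallin Q (fun y => fallin Q (fun z =>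
    fimp (frel g x y) (fimp (frel f y z) (frel h x z))))).

Definition f_sub A B : sentence := fallin A (fun f => fmem f B).

(* A is a group, for a set A of permutations of Q *)
Definition f_group A : sentence :=
  fexin A (fun e => fallin Q (fun x => frel e x x))
  &&& fallin A (fun f => fallin A (fun f' => fexin A (fun h => f_comp f f' h)))
  &&& fallin A (fun f => fexin A (fun h =>
        fallin Q (fun x => fallin Q (fun y => fimp (frel f x y) (frel h y x))))).

Definition f_subgroup A : sentence := f_sub A H &&& f_group A.

Definition f_normal_filter : sentence :=
  fallin K (fun A => f_subgroup A)
  &&& fmem H K
  &&& fallin K (fun A => fall (fun B =>
        fimp (f_sub A B &&& f_subgroup B) (fmem B K)))
  &&& fallin K (fun A => fallin K (fun B => fexin K (fun C =>
        fall (fun f => fiff (fmem f C) (fmem f A &&& fmem f B)))))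
  (* C = h A h^-1: f is in C iff f o h = h o a for some a in A *)
  &&& fallin K (fun A => fallin H (fun h => fexin K (fun C =>
        fallin H (fun f => fiff (fmem f C)
          (fexin A (fun a => fexin H (fun u =>
             f_comp f h u &&& f_comp h a u))))))).

Definition f_symmetric_system : sentence :=
  f_forcing_notion &&& fallin H f_aut &&& f_group H &&& f_normal_filter.

End ForcedSymmetricSystem.

(* every element of G is forced to respect the name x *)
Definition respected (G : set (V -> V)) x :=
  forall g, G g -> forced (feq (name_act g x) x).

End Forcing.

(** * Countable-support symmetric iterations *)

(* Stage a consists of the forcing notion [it_P a], the group [it_G a] of
   automorphisms of it, and the filter [it_F a].  The name of the iterand is
   given by its components: [it_Q a] with order [it_leQ a] and top [it_oneQ a],
   the group [it_H a] and the filter [it_K a].  [it_rho c b] is the restriction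
   from stage b to stage c.  [it_D a] is the set of names allowed at coordinate
   a of a condition. *)
Record iteration (V : zf_universe) := Iteration {
  it_P : V -> poset V;
  it_G : V -> set (V -> V);
  it_F : V -> set (set (V -> V));
  it_Q : V -> V;
  it_leQ : V -> V;
  it_oneQ : V -> V;
  it_H : V -> V;
  it_K : V -> V;
  it_D : V -> V;
  it_rho : V -> V -> (V -> V) -> (V -> V)
}.

Section IterationDefs.
Context {V : zf_universe}.
Variable I : iteration V.
Implicit Types (a b c d l p q s x : V) (g h : V -> V).

Local Notation PP a := (it_P I a).
Local Notation "p ∈P a" := (p ∈ carrier (PP a)) (at level 70).

Definition iterand a :=
  [/\ [/\ is_name (PP a) (it_Q I a), is_name (PP a) (it_leQ I a),
          is_name (PP a) (it_oneQ I a), is_name (PP a) (it_H I a) &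
          is_name (PP a) (it_K I a)],
      forced (PP a) (f_symmetric_system (PP a) (it_Q I a) (it_leQ I a)
                       (it_oneQ I a) (it_H I a) (it_K I a)) &
      [/\ respected (PP a) (it_G I a) (it_Q I a),
          respected (PP a) (it_G I a) (it_leQ I a),
          respected (PP a) (it_G I a) (it_oneQ I a),
          respected (PP a) (it_G I a) (it_H I a) &
          respected (PP a) (it_G I a) (it_K I a)]].

(* Names for conditions are identified when they are forced to be equal:
   [it_D a] contains one representative of each name forced to be in Q_a.
   This also makes the conditions a set. *)
Definition condition_names a :=
  (forall q, q ∈ it_D I a ->
     is_name (PP a) q /\ forced (PP a) (fmem (PP a) q (it_Q I a))) /\
  (forall t, is_name (PP a) t -> forced (PP a) (fmem (PP a) t (it_Q I a)) ->
     exists! q, q ∈ it_D I a /\ forced (PP a) (feq (PP a) t q)).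

(* At every stage conditions are partial functions; an omitted coordinate
   stands for the top condition. *)
Definition iteration_order a := forall p q, p ∈P a -> q ∈P a ->
  (ple (PP a) q p <->
   vsub (vdom p) (vdom q) /\
   forall b, b ∈ vdom p ->
     fmem (PP b) (op_name (PP b) (vapp q b) (vapp p b)) (it_leQ I b)
       (vrestr q b)).

(* (p, q) in P_a * Q_a is represented by the function p U {(a, q)} *)
Definition two_step_conditions a := forall p,
  p ∈P vsucc a <->
  p ∈P a \/
  exists p0 q, [/\ p0 ∈P a, q ∈ it_D I a &
                   p = vcup p0 (vsingle (opair a q))].

Definition cs_limit_conditions l := forall p,
  p ∈P l <->
  [/\ is_pfun p, vsub (vdom p) l, vcountable (vdom p) &
      forall b, b ∈ vdom p -> vapp p b ∈ it_D I b].

Definition direct_limit_conditions l := forall p,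
  p ∈P l <-> exists2 b, b ∈ l & p ∈P b.

(* g is the automorphism (p, q) |-> (pi p, pi (s q)) of P_a * Q_a, for s a name
   for an element of H_a *)
Definition semidirect a (pi : V -> V) s g := forall p, p ∈P vsucc a ->
  [/\ vrestr (g p) a = pi (vrestr p a),
      a ∈ vdom (g p) <-> a ∈ vdom p &
      a ∈ vdom p ->
      forced (PP a) (fmem (PP a)
        (op_name (PP a) (name_act pi (vapp p a)) (vapp (g p) a))
        (name_act pi s))].

Definition two_step_group a : set (V -> V) :=
  [set g | is_aut (PP (vsucc a)) g /\
     exists pi s, [/\ it_G I a pi, is_name (PP a) s,
                      forced (PP a) (fmem (PP a) s (it_H I a)) &
                      semidirect a pi s g]].

Definition pullback c b (H : set (V -> V)) : set (V -> V) :=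
  [set g | it_G I b g /\ H (it_rho I c b g)].

(* the symmetries with head in H and tail forced to be in the group named L *)
Definition tail_symmetries a (H : set (V -> V)) (L : V) : set (V -> V) :=
  [set g | pullback a (vsucc a) H g /\
     exists s, [/\ is_name (PP a) s, forced (PP a) (fmem (PP a) s L) &
                   semidirect a (it_rho I a (vsucc a) g) s g]].

Definition two_step_filter a (FK : set (set (V -> V))) :=
  [/\ normal_filter (it_G I (vsucc a)) FK,
      forall H, it_F I a H -> FK (pullback a (vsucc a) H) &
      forall H L, it_F I a H -> is_name (PP a) L ->
        forced (PP a) (fmem (PP a) L (it_K I a)) -> respected (PP a) H L ->
        FK (tail_symmetries a H L)].

(* Every thread comes from exactly one element of G_l; that elements of G_l
   give threads and act coordinatewise is part of [restriction_maps]. *)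
Definition inverse_limit_group l :=
  forall t : V -> V -> V,
    (forall b, b ∈ l -> it_G I b (t b)) ->
    (forall c b, c ∈ b -> b ∈ l -> it_rho I c b (t b) = t c) ->
    exists! g, it_G I l g /\ forall b, b ∈ l -> it_rho I b l g = t b.

(* g is the extension of h from stage b to stage l with trivial tails: at each
   coordinate d >= b, (g p)(d) = g_d p(d), where g_d is g restricted to P_d *)
Definition canonical_extension b l h g :=
  [/\ is_aut (PP l) g,
      forall p, p ∈P l -> vrestr (g p) b = h (vrestr p b) &
      forall d, d ∈ l -> ord_le b d -> exists2 gd, it_G I d gd &
        forall p, p ∈P l ->
        [/\ vrestr (g p) d = gd (vrestr p d),
            d ∈ vdom (g p) <-> d ∈ vdom p &
            d ∈ vdom p -> forced (PP d)
              (feq (PP d) (vapp (g p) d) (name_act gd (vapp p d)))]].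

Definition direct_limit_group l : set (V -> V) :=
  [set g | exists b h, [/\ b ∈ l, it_G I b h & canonical_extension b l h g]].

Definition limit_base l : set (set (V -> V)) :=
  [set B | exists b H, [/\ b ∈ l, it_F I b H & B = pullback b l H]].

(* The intersection with G_l gives the empty intersection its value. *)
Definition limit_filter l : set (set (V -> V)) :=
  [set K | is_subgroup K (it_G I l) /\
    ((cf_ge_omega1 l /\
      exists (k : nat) (B : nat -> set (V -> V)) (g : nat -> V -> V),
        [/\ forall i, (i < k)%N -> limit_base l (B i),
            forall i, (i < k)%N -> it_G I l (g i) &
            it_G I l `&` \bigcap_(i in [set i | (i < k)%N]) conjugate (g i) (B i)
              `<=` K])
     \/
     (cf_omega l /\
      exists (B : nat -> set (V -> V)) (g : nat -> V -> V),
        [/\ forall n, limit_base l (B n), forall n, it_G I l (g n) &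
            \bigcap_n conjugate (g n) (B n) `<=` K]))].

(* Coherent homomorphisms that restrict the action to initial segments; for
   b limit the last clause is the coordinatewise action of a thread. *)
Definition restriction_maps (Theta : V) :=
  (forall b, ord_le b Theta -> forall g, it_G I b g -> it_rho I b b g = g) /\
  (forall c b, ord_le c b -> ord_le b Theta ->
   [/\ forall g, it_G I b g -> it_G I c (it_rho I c b g),
       forall g h, it_G I b g -> it_G I b h ->
         it_rho I c b (g \o h) = it_rho I c b g \o it_rho I c b h,
       forall d g, ord_le c d -> ord_le d b -> it_G I b g ->
         it_rho I c b g = it_rho I c d (it_rho I d b g) &
       forall g p, it_G I b g -> p ∈P b ->
         vrestr (g p) c = it_rho I c b g (vrestr p c)]).

Definition cs_symmetric_iteration (Theta : V) :=
  [/\ is_ord Theta,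
      (forall a, a ∈ Theta -> iterand a /\ condition_names a) /\
      (forall a, ord_le a Theta ->
         [/\ pone (PP a) = vempty, iteration_order a,
             forcing_notion (PP a) & aut_group (PP a) (it_G I a)]) /\
      restriction_maps Theta,
      [/\ carrier (PP vempty) = vsingle vempty,
          it_G I vempty = [set id] & it_F I vempty = [set [set id]]],
      forall a, a ∈ Theta ->
        [/\ two_step_conditions a, it_G I (vsucc a) = two_step_group a &
            exists2 FK, two_step_filter a FK &
              it_F I (vsucc a) = omega1_completion (it_G I (vsucc a)) FK] &
      forall l, is_limit l -> ord_le l Theta ->
        [/\ cf_omega l -> cs_limit_conditions l /\ inverse_limit_group l,
            cf_ge_omega1 l ->
              direct_limit_conditions l /\ it_G I l = direct_limit_group l &
            it_F I l = limit_filter l]].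

End IterationDefs.

(* Main.v *)
Require Import Defs.
From mathcomp Require Import all_boot.
From mathcomp Require Import boolp classical_sets.

Set Implicit Arguments.
Unset Strict Implicit.
Unset Printing Implicit Defensive.

Local Open Scope classical_set_scope.

(** The canonical name of a tuple is built from flat names
    {(y_n, 1) | n in D}, with D a set of natural numbers: the pairs and the
    check names of natural numbers that occur in it have this form, and so does
    the tuple name itself.  Automorphisms fix 1, so a symmetry of every y_n is a
    symmetry of the flat name ([HS_countable]).  The theorem thus reduces to
    the limit filter being a filter of subgroups that is closed under countable
    intersections.

    If cf(l) = omega, a countable intersection of sets that contain countable
    intersections of conjugates g B g^-1, with B in the base, contains a single
    such countable intersection.

    If cf(l) >= omega_1, the limit filter is generated by finite intersections
    only, and the closure comes from the stages below l.  The conjugate by g of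
    the pullback of H contains the pullback of the conjugate of H by the
    restriction of g ([pullback_conjugate]), so by normality of the earlier
    filters every set in the limit filter contains a countable intersection of
    pullbacks.  The stages of countably many pullbacks are bounded by some c
    below l ([countable_family_bounded]), and the pullbacks to stage c belong to
    the omega_1-complete filter of that stage ([it_F_pullback]); hence so does
    their intersection, whose pullback to stage l is below all the given sets
    ([pullback_bigcap]).

    Both the inductive proof that pullbacks of members of the filters are again
    members and the empty tuple need the case distinction on the cofinality to
    be exhaustive; [cf_dichotomy] proves this inside the universe. *)

(** * Ordinals and cofinality in the ground universe *)

Section Ordinals.
Context {V : zf_universe}.
Implicit Types (a b c d k l x y z : V) (f : V -> V) (u : nat -> V).

Lemma vsingleP x y : x ∈ vsingle y <-> x = y.
Proof. by rewrite zf_upairP; split=> [[]|->]; [| |left]. Qed.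

Lemma vsuccP x y : x ∈ vsucc y <-> x ∈ y \/ x = y.
Proof.
rewrite zf_unionP; split=> [[w /zf_upairP[->|->]]|[xy|->]].
- by left.
- by move=> /vsingleP; right.
- by exists y => //; apply/zf_upairP; left.
- by exists (vsingle y); [apply/zf_upairP; right|apply/vsingleP].
Qed.

Lemma in_vempty x : ~ x ∈ vempty.
Proof. by move=> /zf_sepP[]. Qed.

Lemma in_irrefl x : ~ x ∈ x.
Proof. by elim: (@zf_foundation V x) => {}x _ IH xx; exact: IH (xx). Qed.

Lemma ord_le_refl a : ord_le a a.
Proof. by apply/vsuccP; right. Qed.

Lemma in_ord_le x a : x ∈ a -> ord_le x a.
Proof. by move=> xa; apply/vsuccP; left. Qed.

Lemma is_ord_in a x : is_ord a -> x ∈ a -> is_ord x.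
Proof. by move=> [ta tx] xa; split=> [|y yx]; [apply: tx|apply/tx/(ta x)]. Qed.

Lemma ord_le_in_trans a b d : is_ord d -> ord_le a b -> b ∈ d -> a ∈ d.
Proof. by move=> [td _] /vsuccP[ab bd|-> //]; exact: td ab. Qed.

Lemma in_ord_le_trans a b d : is_ord d -> a ∈ b -> ord_le b d -> a ∈ d.
Proof. by move=> [td _] ab /vsuccP[bd|<- //]; exact: td ab. Qed.

Lemma ord_le_trans a b d : is_ord d -> ord_le a b -> ord_le b d -> ord_le a d.
Proof.
move=> od /vsuccP[ab|->//] bd; apply: in_ord_le.
exact: in_ord_le_trans bd.
Qed.

Lemma is_ord_succ a : is_ord a -> is_ord (vsucc a).
Proof.
move=> [ta tx]; split=> [x /vsuccP[xa|->] y yx|x /vsuccP[/tx//|->//]].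
  by apply/vsuccP; left; exact: ta yx.
by apply/vsuccP; left.
Qed.

Lemma ord_trichotomy a b : is_ord a -> is_ord b -> [\/ a ∈ b, a = b | b ∈ a].
Proof.
elim: (@zf_foundation V a) b => {}a _ IHa b oa ob.
elim: (@zf_foundation V b) ob => {}b _ IHb ob.
have [ab|nab] := pselect (a ∈ b); first exact: Or31.
have [ba|nba] := pselect (b ∈ a); first exact: Or33.
apply: Or32; apply: zf_ext => x; split=> [xa|xb].
  case: (IHa x xa b (is_ord_in oa xa) ob) => // [xb|bx].
    by case: nba; rewrite -xb.
  by case: nba; case: oa => + _; apply; first exact: xa.
case: (IHb x xb (is_ord_in ob xb)) => // [ax|ax].
  by case: nab; case: ob => + _; apply; first exact: xb.
by case: nab; rewrite ax.
Qed.

Lemma ord_leNgt a b : is_ord a -> is_ord b -> ~ b ∈ a -> ord_le a b.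
Proof.
by move=> oa ob nba; apply/vsuccP; case: (ord_trichotomy oa ob); [left|right|].
Qed.

Lemma ord_cases a : is_ord a ->
  [\/ a = vempty, exists2 b, b ∈ a & a = vsucc b | is_limit a].
Proof.
move=> oa; have [->|a0] := pselect (a = vempty); first exact: Or31.
have [sa|/existsNP[b /not_implyP[ba nsa]]] :=
  pselect (forall b, b ∈ a -> vsucc b ∈ a); first exact: Or33.
apply: Or32; exists b => //.
case: (ord_trichotomy oa (is_ord_succ (is_ord_in oa ba))) => // /vsuccP.
move=> [ab|ab]; case: (@in_irrefl a); last by rewrite {1}ab.
by case: oa => ta _; exact: ta ab.
Qed.

Lemma vempty_in_limit l : is_limit l -> vempty ∈ l.
Proof.
move=> [ol l0 _].
have o0 : is_ord (vempty : V) by split=> x /in_vempty.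
by case: (ord_trichotomy o0 ol) => // [e|/in_vempty//]; case: l0.
Qed.

(** ** Natural numbers

    Second-order Separation makes omega standard, which lets sequences indexed
    by [nat] stand for sequences of the universe. *)

Fixpoint numeral n : V := if n is m.+1 then vsucc (numeral m) else vempty.

Lemma omegaP x : x ∈ omega <-> exists n, x = numeral n.
Proof.
have [[e einf e0] sinf] := zf_infP V.
have inf0 : vempty ∈ zf_inf V.
  by rewrite -(_ : e = vempty) //; apply: zf_ext => y; split=> [/e0|/in_vempty].
have infS y : y ∈ zf_inf V -> vsucc y ∈ zf_inf V.
  move=> /sinf[z zinf zP]; rewrite -(_ : z = vsucc y) //; apply: zf_ext => w.
  by rewrite zP vsuccP.
have numeral_in a : inductive_set a -> forall n, numeral n ∈ a.
  by move=> [a0 aS]; elim=> //= n; exact: aS.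
split=> [/zf_sepP[_ xP]|[n ->]]; last first.
  apply/zf_sepP; split=> [|a /numeral_in//]; exact: numeral_in.
suff /xP/zf_sepP[] :
  inductive_set (zf_sep (fun y => exists n, y = numeral n) (zf_inf V)) by [].
split=> [|y /zf_sepP[yinf [n yn]]]; apply/zf_sepP; split=> //.
- by exists 0.
- exact: infS.
- by exists n.+1; rewrite yn.
Qed.

Lemma is_ord_numeral n : is_ord (numeral n).
Proof. by elim: n => [|n]; [split=> x /in_vempty|exact: is_ord_succ]. Qed.

Lemma is_ord_omega : is_ord (omega : V).
Proof.
split=> [x /omegaP[n ->]|x /omegaP[n ->]]; last by have [] := is_ord_numeral n.
elim: n => [y /in_vempty//|n IH y /vsuccP[/IH//|->]].
by apply/omegaP; exists n.
Qed.

Lemma numeralP x n : x ∈ numeral n <-> exists2 m, m < n & x = numeral m.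
Proof.
elim: n => [|n IH] /=; first by split=> [/in_vempty|[]].
rewrite vsuccP IH; split=> [[[m mn ->]|->]|[m]].
- by exists m => //; exact: ltnW.
- by exists n.
- by rewrite ltnS leq_eqVlt => /predU1P[->|mn] ->; [right|left; exists m].
Qed.

Lemma numeral_inj : injective numeral.
Proof.
have neq m n : m < n -> numeral m <> numeral n.
  by move=> mn E; apply: (@in_irrefl (numeral n)); apply/numeralP; exists m.
move=> m n E; case: (ltngtP m n) => // /neq; first by move/(_ E).
by move/(_ (esym E)).
Qed.

(** ** Functions in the universe *)

Definition vlam a f : V := zf_repl (fun x z => z = opair x (f x)) a.

Lemma in_vlam a f x y : opair x y ∈ vlam a f <-> x ∈ a /\ y = f x.
Proof.
rewrite zf_replP => [|? ? ? _ -> -> //].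
by split=> [[x' xa /opair_inj[-> ->]]|[xa ->]]; [|exists x].
Qed.

Lemma fun_on_vlam a f : fun_on (vlam a f) a.
Proof.
split; first split=> [z|x y y' /in_vlam[_ ->] /in_vlam[_ ->]//].
  by rewrite zf_replP => [[x _ ->]|? ? ? _ -> -> //]; exists x, (f x).
apply: zf_ext => x; split=> [/zf_sepP[_ [y /in_vlam[]]]//|xa].
apply/zf_sepP; split; last by exists (f x); apply/in_vlam.
apply/zf_unionP; exists (vsingle x); last exact/vsingleP.
apply/zf_unionP; exists (opair x (f x)); first exact/in_vlam.
by apply/zf_upairP; left.
Qed.

Lemma vapp_vlam a f x : x ∈ a -> vapp (vlam a f) x = f x.
Proof.
move=> xa; apply: zf_ext => z; split=> [/zf_unionP[y /zf_sepP[_]]|zfx].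
  by move=> /in_vlam[_ ->].
have xfx : opair x (f x) ∈ vlam a f by apply/in_vlam.
apply/zf_unionP; exists (f x) => //; apply/zf_sepP; split=> //.
apply/zf_unionP; exists (zf_upair x (f x)); last by apply/zf_upairP; right.
by apply/zf_unionP; exists (opair x (f x)) => //; apply/zf_upairP; right.
Qed.

Lemma fun_to_vlam a b f : (forall x, x ∈ a -> f x ∈ b) -> fun_to (vlam a f) a b.
Proof.
move=> fb; split=> [|x xa]; first exact: fun_on_vlam.
by rewrite vapp_vlam//; exact: fb.
Qed.

Lemma vcountable_sub_omega a : vsub a omega -> vcountable a.
Proof.
move=> aw; exists (vlam a id); split=> [|x y xa ya]; first exact: fun_to_vlam.
by rewrite !vapp_vlam.
Qed.

(** ** Cofinality *)

(** Replacement over arbitrary relations turns a sequence of the ambient logic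
    into an element of the universe. *)
Lemma cofinal_map_omega u l : (forall n, u n ∈ l) ->
  (forall x, x ∈ l -> exists n, ord_le x (u n)) ->
  exists c, cofinal_map c omega l.
Proof.
move=> ul uc.
have /choice[f fP] x : exists y, forall n, x = numeral n -> y = u n.
  have [[n ->]|nx] := pselect (exists n, x = numeral n).
    by exists (u n) => m /numeral_inj ->.
  by exists x => n xn; case: nx; exists n.
exists (vlam omega f); split.
  by apply: fun_to_vlam => x /omegaP[n xn]; rewrite (fP _ _ xn).
move=> x /uc[n xun]; have nw : numeral n ∈ omega by apply/omegaP; exists n.
by exists (numeral n) => //; rewrite vapp_vlam// (fP _ n).
Qed.

(** A limit ordinal is closed under successor and maximum. *)
Lemma finite_family_bounded l n f : is_limit l ->
  (forall x, x ∈ numeral n -> f x ∈ l) ->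
  exists2 b, b ∈ l & forall x, x ∈ numeral n -> f x ∈ b.
Proof.
move=> ll; elim: n => [_|n IH fl].
  by exists vempty => [|x /in_vempty//]; exact: vempty_in_limit.
have [ol _ sl] := ll.
have [|b bl bP] := IH; first by move=> x xn; apply: fl; apply: in_ord_le.
have fnl : f (numeral n) ∈ l by apply: fl; exact: ord_le_refl.
have [ob ofn] := (is_ord_in ol bl, is_ord_in ol fnl).
have [fb|nfb] := pselect (f (numeral n) ∈ b).
  by exists b => // x /vsuccP[/bP//|->].
exists (vsucc (f (numeral n))); first exact: sl.
move=> x /vsuccP[/bP xb|->]; last exact: ord_le_refl.
apply: in_ord_le; apply: (in_ord_le_trans ofn xb).
exact: ord_leNgt nfb.
Qed.

Lemma finite_not_cofinal l n c : is_limit l -> ~ cofinal_map c (numeral n) l.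
Proof.
move=> ll [[_ fl] fc]; have [b bl bP] := finite_family_bounded ll fl.
have ob : is_ord b by have [ol _ _] := ll; exact: is_ord_in bl.
have [y /bP fy bf] := fc b bl.
exact: in_irrefl (ord_le_in_trans ob bf fy).
Qed.

Lemma cf_omega_cofinal l c : is_limit l -> cofinal_map c omega l -> cf_omega l.
Proof.
move=> ll fc; split; [exact: is_ord_omega|by exists c|].
by move=> d /omegaP[n ->] [h]; exact: finite_not_cofinal.
Qed.

(** An injection of cf(l) into omega re-indexes a shortest cofinal map by
    omega, so a countable cofinality is omega. *)
Lemma cf_dichotomy l : is_limit l -> cf_omega l \/ cf_ge_omega1 l.
Proof.
move=> ll; have [ol _ _] := ll.
have [[f fc]|nc] := pselect (exists c, cofinal_map c omega l).
  by left; exact: cf_omega_cofinal fc.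
right.
have : exists k, is_ord k /\ exists c, cofinal_map c k l.
  exists l; split=> //; exists (vlam l id); split; first exact: fun_to_vlam.
  by move=> x xl; exists x; rewrite ?vapp_vlam//; exact: ord_le_refl.
move=> [k []]; elim: (@zf_foundation V k) => {}k _ IH ok kc.
have [[d [dk dc]]|kmin] :=
  pselect (exists d, d ∈ k /\ exists c, cofinal_map c d l).
  exact: IH dk (is_ord_in ok dk) dc.
exists k; first by split=> // d dk dc; apply: kmin; exists d.
move=> [e [[_ ew] einj]]; apply: nc; have [f [[_ fl] fc]] := kc.
have /choice[u uP] n : exists y, y ∈ l /\
    forall x, x ∈ k -> vapp e x = numeral n -> y = vapp f x.
  have [[x [xk exn]]|nx] := pselect (exists x, x ∈ k /\ vapp e x = numeral n).
    exists (vapp f x); split=> [|x' x'k ex'n]; first exact: fl.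
    by congr vapp; apply: einj => //; rewrite exn ex'n.
  (* outside the range of the injection any element of l will do *)
  exists vempty; split=> [|x xk exn]; first exact: vempty_in_limit.
  by case: nx; exists x.
apply: (@cofinal_map_omega u) => [n|x /fc[y yk xfy]]; first by have [] := uP n.
have /omegaP[n eyn] := ew y yk.
by exists n; have [_ /(_ y yk eyn) ->] := uP n.
Qed.

(** An unbounded sequence would be a cofinal map from omega, while omega lies
    below the uncountable cf(l). *)
Lemma countable_family_bounded l u : is_limit l -> cf_ge_omega1 l ->
  (forall n, u n ∈ l) -> exists2 b, b ∈ l & forall n, u n ∈ b.
Proof.
move=> ll [k [ok _ kmin] kunc] ul; have [ol _ _] := ll; apply: contrapT => nb.
have [f fc] : exists c, cofinal_map c omega l.
  apply: (cofinal_map_omega ul) => x xl; apply: contrapT => nx; apply: nb.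
  exists x => // n; have ox := is_ord_in ol xl.
  case: (ord_trichotomy (is_ord_in ol (ul n)) ox) => // [unx|xu];
    case: nx; exists n; first by rewrite unx; exact: ord_le_refl.
  exact: in_ord_le.
case: (ord_trichotomy is_ord_omega ok) => [wk|wk|kw].
- by case: (kmin _ wk); exists f.
- by apply: kunc; rewrite -wk; exact: vcountable_sub_omega.
- apply: kunc; apply: vcountable_sub_omega => x.
  by have [t _] := is_ord_omega; exact: t.
Qed.

Lemma cf_omega_not_ge l : is_limit l -> cf_omega l -> ~ cf_ge_omega1 l.
Proof.
move=> ll [_ [f [[_ fl] fc]] _] lunc.
have [n|b bl bP] :=
    @countable_family_bounded l (fun n => vapp f (numeral n)) ll lunc.
  by apply: fl; apply/omegaP; exists n.
have ob : is_ord b by have [ol _ _] := ll; exact: is_ord_in bl.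
have [_ /omegaP[n ->] bf] := fc b bl.
exact: in_irrefl (ord_le_in_trans ob bf (bP n)).
Qed.

End Ordinals.

(** * Groups of permutations *)

Section Groups.
Variable T : Type.
Implicit Types (g h : T -> T) (G H K : set (T -> T)).

Lemma subgroup_refl G : is_group G -> is_subgroup G G.
Proof. by split. Qed.

Lemma is_group_bigcap (H : nat -> set (T -> T)) :
  (forall n, is_group (H n)) -> is_group (\bigcap_n H n).
Proof.
move=> gH; split=> [n _|f g Hf Hg n _|f Hf]; first by have [] := gH n.
  by have [_ + _] := gH n; apply; [exact: Hf|exact: Hg].
have [_ _ /(_ f (Hf 0 Logic.I))[g [_ fg gf]]] := gH 0.
exists g; split=> // n _.
have [_ _ /(_ f (Hf n Logic.I))[g' [Hg' fg' _]]] := gH n.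
by rewrite (_ : g = g') // -[RHS]/(id \o g') -gf -compA fg'.
Qed.

Lemma conjugate_id H : conjugate id H = H.
Proof.
apply/seteqP; split=> [k [h Hh kh]|k Hk]; last by exists k.
by rewrite (_ : k = h).
Qed.

Lemma subgroup_filter_complete_bigcap G (F : set (set (T -> T))) :
  subgroup_filter G F -> omega1_complete F ->
  forall (H : nat -> set (T -> T)) K, (forall n, F (H n)) ->
  \bigcap_n H n `<=` K -> is_subgroup K G -> F K.
Proof. by move=> [_ _ up _] cF H K /cF FH; exact: up. Qed.

End Groups.

(** * Restriction maps and the limit filter *)

Section Iteration.
Context {V : zf_universe}.
Variables (I : iteration V) (Theta : V).
Hypothesis iter : cs_symmetric_iteration I Theta.
Implicit Types (a b c l : V) (g h : V -> V) (H K : set (V -> V)).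

Let Theta_ord : is_ord Theta.
Proof. by case: iter. Qed.

Lemma it_G_group b : ord_le b Theta -> is_group (it_G I b).
Proof. by case: iter => _ [_ [st _]] _ _ _ /st[_ _ _ []]. Qed.

Lemma it_rho_G c b g : ord_le c b -> ord_le b Theta ->
  it_G I b g -> it_G I c (it_rho I c b g).
Proof.
case: iter => _ [_ [_ [_ st]]] _ _ _ cb bT.
by have [+ _ _ _] := st _ _ cb bT; apply.
Qed.

Lemma it_rho_comp c b g h : ord_le c b -> ord_le b Theta ->
  it_G I b g -> it_G I b h ->
  it_rho I c b (g \o h) = it_rho I c b g \o it_rho I c b h.
Proof.
case: iter => _ [_ [_ [_ st]]] _ _ _ cb bT.
by have [_ + _ _] := st _ _ cb bT; apply.
Qed.

Lemma it_rho_trans c d b g : ord_le c d -> ord_le d b -> ord_le b Theta ->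
  it_G I b g -> it_rho I c b g = it_rho I c d (it_rho I d b g).
Proof.
case: iter => _ [_ [_ [_ st]]] _ _ _ cd db bT.
have ob : is_ord b by case/vsuccP: bT => [/(is_ord_in Theta_ord)|->].
by have [_ _ + _] := st _ _ (ord_le_trans ob cd db) bT; apply.
Qed.

Lemma it_rho_refl b g : ord_le b Theta -> it_G I b g -> it_rho I b b g = g.
Proof. by case: iter => _ [_ [_ [st _]]] _ _ _ bT; exact: st. Qed.

(** The image of the identity is an idempotent of a group. *)
Lemma it_rho_id c b : ord_le c b -> ord_le b Theta -> it_rho I c b id = id.
Proof.
move=> cb bT; have [Gid _ _] := it_G_group bT.
have ob : is_ord b by case/vsuccP: bT => [/(is_ord_in Theta_ord)|->].
have cT : ord_le c Theta by exact: ord_le_trans cb bT.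
have [_ _ Gc] := it_G_group cT.
have [e [_ _ eK]] := Gc _ (it_rho_G cb bT Gid).
have /(congr1 (comp e)) := it_rho_comp cb bT Gid Gid.
by rewrite compA eK => /esym.
Qed.

Lemma pullback_group c b H : ord_le c b -> ord_le b Theta ->
  is_subgroup H (it_G I c) -> is_subgroup (pullback I c b H) (it_G I b).
Proof.
move=> cb bT [HG [Hid Hcomp Hinv]]; split=> [g []//|].
have [Gid Gcomp Ginv] := it_G_group bT.
split=> [|f g [Gf Hf] [Gg Hg]|f [Gf Hf]].
- by split=> //; rewrite it_rho_id.
- by split; [exact: Gcomp|rewrite (it_rho_comp cb bT Gf Gg); exact: Hcomp].
have [g [Gg fg gf]] := Ginv _ Gf; exists g; split=> //; split=> //.
have [h [Hh fh hf]] := Hinv _ Hf; rewrite (_ : it_rho I c b g = h) //.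
rewrite -[LHS]/(it_rho I c b g \o id) -fh compA -(it_rho_comp cb bT Gg Gf) gf.
by rewrite it_rho_id.
Qed.

(** Conjugating a pullback by g pulls back the conjugate by the restriction of
    g; hence normality of the earlier filters absorbs the conjugates in the
    description of the limit filter. *)
Lemma pullback_conjugate c b g H : ord_le c b -> ord_le b Theta ->
  it_G I b g -> pullback I c b (conjugate (it_rho I c b g) H) `<=`
                conjugate g (pullback I c b H).
Proof.
move=> cb bT Gg f [Gf [h Hh fgh]]; have [_ Gcomp Ginv] := it_G_group bT.
have [k [Gk gk kg]] := Ginv _ Gg; exists (k \o (f \o g)); last first.
  by rewrite compA gk.
have Gfg := Gcomp _ _ Gf Gg; split; first exact: Gcomp.
rewrite (it_rho_comp cb bT Gk Gfg) (it_rho_comp cb bT Gf Gg) fgh compA.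
by rewrite -(it_rho_comp cb bT Gk Gg) kg it_rho_id.
Qed.

Lemma pullback_refl b H :
  ord_le b Theta -> H `<=` it_G I b -> pullback I b b H = H.
Proof.
move=> bT HG; apply/seteqP; split=> [g [Gg]|g Hg]; first by rewrite it_rho_refl.
by split; [exact: HG|rewrite it_rho_refl//; exact: HG].
Qed.

Lemma pullback_trans c d b H : ord_le c d -> ord_le d b -> ord_le b Theta ->
  pullback I d b (pullback I c d H) = pullback I c b H.
Proof.
move=> cd db bT; apply/seteqP; split=> [g [Gg [_ Hg]]|g [Gg Hg]].
  by split=> //; rewrite (it_rho_trans cd db).
by split=> //; split; [exact: it_rho_G|rewrite -it_rho_trans].
Qed.

Lemma limit_base_filter l B : is_limit l -> ord_le l Theta ->
  limit_base I l B -> is_subgroup B (it_G I l) -> limit_filter I l B.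
Proof.
move=> ll lT lB sB; have [Gid _ _] := it_G_group lT; split=> //.
case: (cf_dichotomy ll) => cf; [right|left]; split=> //.
  exists (fun=> B), (fun=> id); split=> // g /(_ 0 Logic.I).
  by rewrite conjugate_id.
exists 1, (fun=> B), (fun=> id); split=> // g [_ /(_ 0 isT)].
by rewrite conjugate_id.
Qed.

(** Every step of the iteration puts the pullbacks of the earlier filters into
    the new one; at a limit step this needs that one of the two clauses defining
    the limit filter applies. *)
Lemma it_F_pullback c b H : ord_le c b -> ord_le b Theta ->
  is_subgroup H (it_G I c) -> it_F I c H -> it_F I b (pullback I c b H).
Proof.
move=> + + sH FH; elim: (@zf_foundation V b) => {}b _ IH cb bT.
have ob : is_ord b by case/vsuccP: bT => [/(is_ord_in Theta_ord)|->].
case/vsuccP: (cb) => [cb'|cb']; last first.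
  by rewrite -cb' pullback_refl //; [rewrite cb'|case: sH].
have sub := pullback_group cb bT sH.
case: (ord_cases ob) => [b0|[a ab bE]|lb].
- by move: cb'; rewrite b0 => /in_vempty.
- have ca : ord_le c a by rewrite bE in cb'.
  have aT : a ∈ Theta by apply: in_ord_le_trans bT.
  have ab' := in_ord_le ab.
  case: (iter) => _ _ _ /(_ a aT)[_ _ [FK [[Kfil _] KF _] FE]] _.
  have KH : FK (pullback I c b H).
    rewrite -(pullback_trans H ca ab' bT) bE; apply: KF.
    by apply: IH => //; exact: in_ord_le.
  rewrite {1}bE FE; split; first by rewrite -bE.
  by exists (fun=> pullback I c b H) => // g /(_ 0 Logic.I).
- case: (iter) => _ _ _ _ /(_ b lb bT)[_ _ ->].
  by apply: limit_base_filter => //; exists c, H.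
Qed.

Section LimitStage.
Variable l : V.
Hypotheses (ll : is_limit l) (lT : ord_le l Theta).
Hypothesis normal_complete : forall b, b ∈ l ->
  normal_filter (it_G I b) (it_F I b) /\ omega1_complete (it_F I b).

Let l_ord : is_ord l.
Proof. by case: ll. Qed.

Let le_Theta b : b ∈ l -> ord_le b Theta.
Proof. by move=> bl; apply: in_ord_le; exact: in_ord_le_trans lT. Qed.

Let it_F_subgroup b H : b ∈ l -> it_F I b H -> is_subgroup H (it_G I b).
Proof. by move=> /normal_complete[[[+ _ _ _] _] _]; apply. Qed.

(** Countably many stages below a limit of uncountable cofinality lie below one
    stage, whose filter is omega_1-complete. *)
Lemma pullback_bigcap (b : nat -> V) (H : nat -> set (V -> V)) :
  cf_ge_omega1 l -> (forall n, b n ∈ l /\ it_F I (b n) (H n)) ->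
  exists c L, [/\ c ∈ l, it_F I c L &
                  pullback I c l L `<=` \bigcap_n pullback I (b n) l (H n)].
Proof.
move=> cf bH; have [|c cl bc] := countable_family_bounded ll cf (u := b).
  by move=> n; have [] := bH n.
exists c, (\bigcap_n pullback I (b n) c (H n)); split=> //.
  have [_] := normal_complete cl; apply=> n; have [bl FH] := bH n.
  apply: it_F_pullback => //; first exact: in_ord_le.
  - exact: le_Theta.
  - exact: it_F_subgroup.
move=> g [Gg Hg] n _; have [_ {}Hg] := Hg n Logic.I; split=> //.
by rewrite (it_rho_trans (in_ord_le (bc n)) (in_ord_le cl)).
Qed.

(** This normal form of the members carries no conjugates and no finite
    intersections, which is what makes countable intersections tractable. *)
Lemma limit_filter_ge_omega1P K : cf_ge_omega1 l -> is_subgroup K (it_G I l) ->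
  limit_filter I l K <->
  exists c L, [/\ c ∈ l, it_F I c L & pullback I c l L `<=` K].
Proof.
move=> cf sK; split.
  move=> [_ [[_ [k [B [g [Bl Gg BK]]]]]|[/(cf_omega_not_ge ll)//]]].
  (* the whole group of stage 0 replaces the missing members of the family *)
  have /choice[bH bHP] n : exists bH : V * set (V -> V),
      (bH.1 ∈ l /\ it_F I bH.1 bH.2) /\
      (n < k -> pullback I bH.1 l bH.2 `<=` conjugate (g n) (B n)).
    case: (ltnP n k) => [nk|_]; last first.
      have l0 := vempty_in_limit ll; exists (vempty, it_G I vempty).
      by split=> //; split=> //; have [[[]]] := normal_complete l0.
    have [b [H [bl FH ->]]] := Bl n nk; have bl' := in_ord_le bl.
    exists (b, conjugate (it_rho I b l (g n)) H); split=> [|_].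
      split=> //; have [[_ + _]] := normal_complete bl; apply=> //.
      by apply: it_rho_G => //; exact: Gg.
    by apply: pullback_conjugate => //; exact: Gg.
  have [n|c [L [cl FL LK]]] :=
    @pullback_bigcap (fun n => (bH n).1) (fun n => (bH n).2) cf.
    by have [] := bHP n.
  exists c, L; split=> // f Lf; apply: BK; split; first by case: Lf.
  by move=> n /= nk; have [_ /(_ nk)] := bHP n; apply; exact: LK Lf _ _.
move=> [c [L [cl FL LK]]]; split=> //; left; split=> //.
exists 1, (fun=> pullback I c l L), (fun=> id).
split=> [_ _|_ _|f [_ /(_ 0 isT)]].
- by exists c, L.
- by have [] := it_G_group lT.
- by rewrite conjugate_id => /LK.
Qed.

(** For uncountable cofinality the finitely generated filter is closed under
    countable intersections because pullbacks can be moved to a common stage;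
    for cofinality omega a sequence of sequences is re-indexed by one. *)
Lemma limit_filter_bigcap (H : nat -> set (V -> V)) K :
  (forall n, limit_filter I l (H n)) -> is_subgroup K (it_G I l) ->
  \bigcap_n H n `<=` K -> limit_filter I l K.
Proof.
move=> FH sK HK; case: (cf_dichotomy ll) => cf; last first.
  apply/limit_filter_ge_omega1P => //.
  have /choice[bL bLP] n : exists bL : V * set (V -> V),
      (bL.1 ∈ l /\ it_F I bL.1 bL.2) /\ pullback I bL.1 l bL.2 `<=` H n.
    have sH : is_subgroup (H n) (it_G I l) by case: (FH n).
    have [c [L [cl FL LH]]] := (limit_filter_ge_omega1P cf sH).1 (FH n).
    by exists (c, L).
  have [n|c [L [cl FL LH]]] :=
    @pullback_bigcap (fun n => (bL n).1) (fun n => (bL n).2) cf.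
    by have [] := bLP n.
  exists c, L; split=> // f /LH Lf; apply: HK => n _.
  by have [_] := bLP n; apply; exact: Lf.
split=> //; right; split=> //.
have /choice[Bg BgP] n : exists Bg : nat -> set (V -> V) * (V -> V),
    (forall m, limit_base I l (Bg m).1 /\ it_G I l (Bg m).2) /\
    \bigcap_m conjugate (Bg m).2 (Bg m).1 `<=` H n.
  have [_ [[/(cf_omega_not_ge ll cf)]//|[_ [B [g [lB Gg BH]]]]]] := FH n.
  by exists (fun m => (B m, g m)); split=> // m; split; [exact: lB|exact: Gg].
(* [code] enumerates all pairs of natural numbers, possibly with repetitions *)
pose code i : nat * nat := odflt (0, 0) (unpickle i).
exists (fun i => (Bg (code i).1 (code i).2).1),
       (fun i => (Bg (code i).1 (code i).2).2); split=> [i|i|f Bf].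
- by have [/(_ (code i).2)[]] := BgP (code i).1.
- by have [/(_ (code i).2)[]] := BgP (code i).1.
apply: HK => n _; have [_] := BgP n; apply=> m _.
by have /(_ Logic.I) := Bf (pickle (n, m)); rewrite /code pickleK.
Qed.

(** The whole group is the pullback of the whole group of stage 0. *)
Lemma limit_filter_group : limit_filter I l (it_G I l).
Proof.
have l0 := vempty_in_limit ll.
have [[[_ F0 _ _] _] _] := normal_complete l0.
have sG := subgroup_refl (it_G_group lT).
apply: (@limit_filter_bigcap (fun=> pullback I vempty l (it_G I vempty))) => //.
  move=> _; apply: limit_base_filter => //.
    by exists vempty, (it_G I vempty).
  apply: pullback_group => //; first exact: in_ord_le.
  exact: it_F_subgroup.
by move=> g /(_ 0 Logic.I)[].
Qed.

Lemma limit_filter_subgroup_filter :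
  subgroup_filter (it_G I l) (limit_filter I l).
Proof.
have sub H : limit_filter I l H -> is_subgroup H (it_G I l) by case.
split=> [//||H K FH HK sK|H K FH FK].
- exact: limit_filter_group.
- by apply: (@limit_filter_bigcap (fun=> H)) => // g /(_ 0 Logic.I) /HK.
have HKE : \bigcap_n (if n is 0 then H else K) = H `&` K.
  apply/seteqP; split=> [g Hg|g [Hg Kg] [|n] _ //].
  by split; [exact: Hg 0 _|exact: Hg 1 _].
apply: (@limit_filter_bigcap (fun n => if n is 0 then H else K)) => [[|n]//||].
  split=> [g [/(sub _ FH).1]//|]; rewrite -HKE; apply: is_group_bigcap.
  by case=> [|n]; [have [] := sub _ FH|have [] := sub _ FK].
by rewrite HKE.
Qed.

Lemma limit_filter_omega1_complete : omega1_complete (limit_filter I l).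
Proof.
move=> H FH; have sub n : is_subgroup (H n) (it_G I l) by case: (FH n).
apply: (@limit_filter_bigcap H) => //; split.
  by move=> g /(_ 0 Logic.I); have [HG _] := sub 0; exact: HG.
by apply: is_group_bigcap => n; have [] := sub n.
Qed.

End LimitStage.
End Iteration.

(** * Symmetries of names *)

Section Names.
Context {V : zf_universe}.
Variable P : poset V.
Implicit Types (g h : V -> V) (x y z j : V).

Lemma name_act_id x : is_name P x -> name_act id x = x.
Proof.
elim: (name_dom_wf x) => {}x _ IH nx; apply: zf_ext => z.
have nxP : forall z, z ∈ x ->
    exists y p, [/\ z = opair y p, is_name P y & p ∈ carrier P] by case: nx.
rewrite name_actE; split=> [[y [p [yp ->]]]|zx].
  have [y' [p' [/opair_inj[yE _] ny _]]] := nxP _ yp.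
  by rewrite IH //; [exists p|rewrite yE].
have [y [p [zE ny _]]] := nxP _ zx; exists y, p.
by rewrite IH -?zE //; exists p; rewrite -zE.
Qed.

Lemma name_act_comp g h x : name_act (g \o h) x = name_act g (name_act h x).
Proof.
elim: (name_dom_wf x) => {}x _ IH; apply: zf_ext => z; rewrite !name_actE.
split=> [[y [p [yp ->]]]|].
  exists (name_act h y), (h p); rewrite IH; last by exists p.
  by split=> //; apply/name_actE; exists y, p.
move=> [y' [p' [/name_actE[y [p [yp /opair_inj[-> ->]]]] ->]]].
by exists y, p; rewrite IH; last by exists p.
Qed.

Lemma is_subgroup_sym (G : set (V -> V)) x :
  is_group G -> is_name P x -> is_subgroup (sym G x) G.
Proof.
move=> [Gid Gcomp Ginv] nx; split=> [g []//|]; split.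
- by split=> //; exact: name_act_id.
- move=> g h [Gg gx] [Gh hx]; split; first exact: Gcomp.
  by rewrite name_act_comp hx.
- move=> g [Gg gx]; have [h [Gh gh hg]] := Ginv _ Gg; exists h; split=> //.
  by split=> //; rewrite -{1}gx -name_act_comp hg name_act_id.
Qed.

Section HereditarilySymmetric.
Variables (G : set (V -> V)) (F : set (set (V -> V))).
Hypotheses (P1 : pone P ∈ carrier P) (autG : aut_group P G).
Hypotheses (filF : subgroup_filter G F) (cF : omega1_complete F).

Local Notation HS := (HS P G F).

(** An automorphism fixes the top condition, so it fixes x as soon as it fixes
    every [y n]; hence the symmetry group of x contains a countable intersection
    of members of [F]. *)
Lemma HS_countable (D : set nat) (y : nat -> V) x :
  (forall z, z ∈ x <-> exists2 n, D n & z = opair (y n) (pone P)) ->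
  (forall n, D n -> HS (y n)) -> HS x.
Proof.
move=> xP yHS; have [grG autG'] := autG.
have nx : is_name P x.
  by constructor=> z /xP[n /yHS[ny _] ->]; exists (y n), (pone P).
split; first exact: nx.
constructor=> [|y' [p /xP[n /yHS[_ hy] /opair_inj[-> _]]]]; last exact: hy.
(* for n outside D the n-th factor of the intersection is the whole group *)
pose K n := [set g | G g /\ (D n -> name_act g (y n) = y n)].
apply: (subgroup_filter_complete_bigcap filF cF (H := K)).
- move=> n; have [Dn|nDn] := pselect (D n).
    rewrite (_ : K n = sym G (y n)); first by case: (yHS n Dn) => _ [].
    by apply/seteqP; split=> g [Gg gy]; split=> // *; exact: gy.
  rewrite (_ : K n = G); first by case: filF.
  by apply/seteqP; split=> g; [case|].
- move=> g Kg; have [Gg _] := Kg 0 Logic.I; split=> //.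
  have g1 : g (pone P) = pone P by case: (autG' _ Gg).
  apply: zf_ext => z; rewrite name_actE; split.
    move=> [y' [p [/xP[n Dn /opair_inj[-> ->]] ->]]].
    have [_ /(_ Dn) gy] := Kg n Logic.I.
    by apply/xP; exists n => //; rewrite gy g1.
  move=> /xP[n Dn ->]; have [_ /(_ Dn) gy] := Kg n Logic.I.
  by exists (y n), (pone P); rewrite gy g1; split=> //; apply/xP; exists n.
- exact: is_subgroup_sym.
Qed.

Lemma HS_upair x y :
  HS x -> HS y -> HS (zf_upair (opair x (pone P)) (opair y (pone P))).
Proof.
move=> hx hy; apply: (@HS_countable setT (fun n => if n is 0 then x else y)).
  move=> z; rewrite zf_upairP; split=> [[->|->]|[[|n] _ ->]].
  - by exists 0.
  - by exists 1.
  - by left.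
  - by right.
by case.
Qed.

Lemma HS_op_name x y : HS x -> HS y -> HS (op_name P x y).
Proof. by move=> hx hy; apply: HS_upair; exact: HS_upair. Qed.

Lemma HS_check_numeral n : HS (check P (numeral n)).
Proof.
elim/ltn_ind: n => n IH.
apply: (@HS_countable [set m | m < n] (check P \o numeral)) => // z.
rewrite checkE; split=> [[w /numeralP[m mn ->] ->]|[m mn ->]].
  by exists m.
by exists (numeral m) => //; apply/numeralP; exists m.
Qed.

Lemma HS_tuple_name J x : vsub J omega ->
  (forall j, j ∈ J -> HS (vapp x j)) -> HS (tuple_name P J x).
Proof.
move=> Jw xHS; apply: (@HS_countable [set n | numeral n ∈ J]
  (fun n => op_name P (check P (numeral n)) (vapp x (numeral n)))); last first.
  by move=> n Jn; apply: HS_op_name; [exact: HS_check_numeral|exact: xHS].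
move=> z; rewrite zf_replP => [|? ? ? _ -> -> //].
split=> [[j jJ ->]|[n Jn ->]]; last by exists (numeral n).
by have /omegaP[n jn] := Jw j jJ; exists n; rewrite /= -jn.
Qed.

End HereditarilySymmetric.
End Names.

Theorem theorem3p15 (V : zf_universe) (I : iteration V) (Theta lambda : V)
    (iter : cs_symmetric_iteration I Theta)
    (lambda_limit : is_limit lambda) (lambda_le : ord_le lambda Theta)
    (inductive_assumption : forall b, b ∈ lambda ->
       normal_filter (it_G I b) (it_F I b) /\ omega1_complete (it_F I b)) :
  (forall x : V, fun_on x omega ->
     (forall n, n ∈ omega ->
        HS (it_P I lambda) (it_G I lambda) (limit_filter I lambda) (vapp x n)) ->
     HS (it_P I lambda) (it_G I lambda) (limit_filter I lambda)
        (tuple_name (it_P I lambda) omega x)) /\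
  (forall k x : V, k ∈ omega -> fun_on x k ->
     (forall j, j ∈ k ->
        HS (it_P I lambda) (it_G I lambda) (limit_filter I lambda) (vapp x j)) ->
     HS (it_P I lambda) (it_G I lambda) (limit_filter I lambda)
        (tuple_name (it_P I lambda) k x)).
Proof.
have [_ [_ [/(_ _ lambda_le)[_ _ [P1 _ _] autG] _]] _ _ _] := iter.
have filF := limit_filter_subgroup_filter iter lambda_limit lambda_le
               inductive_assumption.
have cF := limit_filter_omega1_complete iter lambda_limit lambda_le
             inductive_assumption.
split=> [x _ xHS|k x kw _ xHS]; apply: HS_tuple_name => //.
by have [t _] := @is_ord_omega V; exact: t.
Qed.
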